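(* For every $n\geq 0$, the $n$-th entry $a_n$ of the sequence A088221 of the OEIS (indexed from $n=0$) counts the number of ordered pairs $(C_1,C_2)$ of connected chord diagrams (allowing empty diagrams) with total number of chords equal to $n$.
   Context: A (rooted) chord diagram of size $n\ge 0$ is a perfect matching of $\{1,\ldots,2n\}$; each pair $\{a<b\}$ is a chord. Two chords $\{v_1<v_2\}$ and $\{w_1<w_2\}$ cross if $v_1<w_1<v_2<w_2$ or $w_1<v_1<w_2<v_2$. The intersection graph has the chords as vertices and an edge for each crossing pair. A nonempty chord diagram is connected if its intersection graph is connected; in the pairs above each $C_i$ is either a nonempty connected chord diagram or the empty diagram. A chord diagram is indecomposable if it is not the concatenation (side by side, with the points placed left to right on a line) of two or more nonempty chord diagrams; the empty diagram counts as indecomposable. $I(x)=1+x+2x^2+10x^3+74x^4+706x^5+\cdots$ is the ordinary generating function, by number of chords, of indecomposable chord diagrams (including the empty one). The sequence A088221, which begins $1,2,3,10,63,558,6226,82836,\ldots$, is defined to be the sequence $(a_n)_{n\ge 0}$ with $a_0=1$ whose ordinary generating series $A(x)=\sum_{n\ge0}a_nx^n$ satisfies $[x^n]A(x)^n=[x^{n+1}]I(x)$ for all $n\geq 0$. *)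

(* Defs.v *)
From HB Require Import structures.
From mathcomp Require Import all_boot all_order all_algebra.
From mathcomp Require Import boolp.
From mathcomp Require Import ring.

Set Implicit Arguments.
Unset Strict Implicit.
Unset Printing Implicit Defensive.

Import GRing.Theory.

(* A chord {a < b} is the pair (a, b); the 2n points are numbered from 0. *)
Definition chord (n : nat) : finType := ('I_n.*2 * 'I_n.*2)%type.

Definition endpoint n (p : 'I_n.*2) (c : chord n) : bool :=
  (p == c.1) || (p == c.2).

Definition perfect_matching n (M : {set chord n}) : bool :=
  [forall c in M, c.1 < c.2] && [forall p, #|[set c in M | endpoint p c]| == 1].

Record diagram (n : nat) := Diagram {
  chords :> {set chord n};
  _ : perfect_matching chords }.

HB.instance Definition _ n := [isSub for @chords n].
HB.instance Definition _ n := [Finite of diagram n by <:].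

Definition crossing n (v w : chord n) : bool :=
  [&& v.1 < w.1, w.1 < v.2 & v.2 < w.2] || [&& w.1 < v.1, v.1 < w.2 & w.2 < v.2].

Definition intersection_graph n (D : diagram n) : rel (chord n) :=
  fun v w => [&& v \in chords D, w \in chords D & crossing v w].

Definition connected n (D : diagram n) : bool :=
  (0 < n) &&
  [forall v in chords D, forall w in chords D, connect (intersection_graph D) v w].

Definition connected_or_empty n (D : diagram n) : bool := (n == 0) || connected D.

Lemma perfect_matchingP n (M : {set chord n}) :
  reflect ((forall c, c \in M -> c.1 < c.2) /\
           forall p, exists2 c, c \in M /\ endpoint p c &
             forall d, d \in M -> endpoint p d -> d = c)
          (perfect_matching M).
Proof.
apply: (iffP andP) => -[H1 H2]; split.
- by move=> c; apply/implyP; move/forallP: H1.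
- move=> p; have /cards1P[c /setP Hc] := forallP H2 p; exists c.
    by have := Hc c; rewrite !inE eqxx => /andP[].
  by move=> d dM pd; have := Hc d; rewrite !inE dM pd => /esym/eqP.
- by apply/forallP => c; apply/implyP; apply: H1.
- apply/forallP => p; have [c [cM pc] Hc] := H2 p; apply/cards1P; exists c.
  apply/setP => d; rewrite !inE; apply/andP/eqP => [[dM pd]|->] //.
  exact: Hc.
Qed.

Definition left_point m k (i : 'I_m.*2) : 'I_(m + k).*2 :=
  cast_ord (esym (doubleD m k)) (lshift k.*2 i).

Definition right_point m k (i : 'I_k.*2) : 'I_(m + k).*2 :=
  cast_ord (esym (doubleD m k)) (rshift m.*2 i).

Definition left_chord m k (c : chord m) : chord (m + k) :=
  (left_point k c.1, left_point k c.2).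

Definition right_chord m k (c : chord k) : chord (m + k) :=
  (right_point m c.1, right_point m c.2).

Definition concat_chords m k (D : diagram m) (E : diagram k) : {set chord (m + k)} :=
  [set left_chord k c | c in chords D] :|: [set right_chord m c | c in chords E].

Lemma concat_subproof m k (D : diagram m) (E : diagram k) :
  perfect_matching (concat_chords D E).
Proof.
have /perfect_matchingP[D1 D2] := valP D.
have /perfect_matchingP[E1 E2] := valP E.
have eqL (i j : 'I_m.*2) : (left_point k i == left_point k j) = (i == j) by [].
have eqR (i j : 'I_k.*2) : (right_point m i == right_point m j) = (i == j).
  by rewrite -!val_eqE /= eqn_add2l.
have eqLR (i : 'I_m.*2) (j : 'I_k.*2) : (left_point k i == right_point m j) = false.
  by rewrite -val_eqE /= ltn_eqF // ltn_addr.
have eqRL (i : 'I_m.*2) (j : 'I_k.*2) : (right_point m j == left_point k i) = false.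
  by rewrite eq_sym eqLR.
apply/perfect_matchingP; split.
  move=> c; rewrite inE => /orP[] /imsetP[d dM ->] /=; first exact: D1.
  by rewrite ltn_add2l; apply: E1.
move=> p; rewrite -[p](cast_ordK (doubleD m k)).
case: (split_ordP (cast_ord (doubleD m k) p)) => i ->.
- rewrite -/(left_point k i); have [c [cM ic] Hc] := D2 i.
  exists (left_chord k c).
    by split=> //; rewrite inE imset_f.
  move=> d; rewrite inE => /orP[] /imsetP[d' d'M ->].
    by rewrite /endpoint !eqL => /(Hc _ d'M) ->.
  by rewrite /endpoint !eqLR.
- rewrite -/(right_point m i); have [c [cM ic] Hc] := E2 i.
  exists (right_chord m c).
    by split; [rewrite inE imset_f ?orbT | rewrite /endpoint !eqR].
  move=> d; rewrite inE => /orP[] /imsetP[d' d'M ->].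
    by rewrite /endpoint !eqRL.
  by rewrite /endpoint !eqR => /(Hc _ d'M) ->.
Qed.

Definition concat m k (D : diagram m) (E : diagram k) : diagram (m + k) :=
  Diagram (concat_subproof D E).

Lemma empty_subproof : perfect_matching (set0 : {set chord 0}).
Proof. by apply/perfect_matchingP; split=> [c|[]//]; rewrite inE. Qed.

Definition empty_diagram : diagram 0 := Diagram empty_subproof.

(* Diagrams of arbitrary size: the tag is the number of chords. *)
Definition sized_diagram : Type := {n : nat & diagram n}.

Definition concat_seq (s : seq sized_diagram) : sized_diagram :=
  foldr (fun D E => Tagged diagram (concat (tagged D) (tagged E)))
        (Tagged diagram empty_diagram) s.

Definition indecomposable n (D : diagram n) : Prop :=
  ~ exists s : seq sized_diagram,
      [/\ 1 < size s, all (fun E => 0 < tag E) s & concat_seq s = Tagged diagram D].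

Definition num_indecomposable (n : nat) : nat :=
  #|[set D : diagram n | `[< indecomposable D >]]|.

(* The ordered pairs of chord diagrams with n chords in total: the tag i is
   the number of chords of the first component. *)
Definition diagram_pair (n : nat) : finType :=
  {i : 'I_n.+1 & (diagram i * diagram (n - i))%type}.

Definition num_connected_pairs (n : nat) : nat :=
  #|[set u : diagram_pair n |
      connected_or_empty (tagged u).1 && connected_or_empty (tagged u).2]|.

Local Open Scope ring_scope.

(* A formal power series over rat is its sequence of coefficients. *)
Definition series_one : nat -> rat := fun n => (n == 0%N)%:R.

Definition series_mul (a b : nat -> rat) : nat -> rat :=
  fun n => \sum_(i < n.+1) a i * b (n - i)%N.

Definition series_exp (a : nat -> rat) (k : nat) : nat -> rat :=
  iter k (series_mul a) series_one.

Definition is_A088221 (a : nat -> rat) : Prop :=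
  a 0%N = 1 /\
  forall n : nat, series_exp a n n = (num_indecomposable n.+1)%:R.

(* The two conditions of is_A088221 determine a unique rational sequence. *)

Lemma series_exp0 a k : a 0%N = 1 -> series_exp a k 0 = 1.
Proof.
move=> a0; elim: k => [|k IH] //=.
by rewrite /series_mul big_ord1 /= a0 mul1r subnn.
Qed.

Lemma eq_series_exp a b k n :
  (forall i, (i <= n)%N -> a i = b i) -> series_exp a k n = series_exp b k n.
Proof.
elim: k n => [|k IH] n ab //=; apply: eq_bigr => i _; congr (_ * _).
  by rewrite ab // -ltnS.
by apply: IH => j jn; apply: ab; apply: leq_trans jn (leq_subr _ _).
Qed.

Lemma series_exp_diff a b k n : (0 < n)%N -> a 0%N = 1 ->
  (forall i, (i < n)%N -> a i = b i) ->
  series_exp a k n = series_exp b k n + k%:R * (a n - b n).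
Proof.
case: n => // n _ a0 ab; have b0 : b 0%N = 1 by rewrite -ab.
have mulE (u v : nat -> rat) : series_mul u v n.+1 =
    u 0%N * v n.+1 + (\sum_(i < n) u i.+1 * v (n - i)%N + u n.+1 * v 0%N).
  by rewrite /series_mul big_ord_recl big_ord_recr subn0 /= /bump /= !add1n subnn.
elim: k => [|k IH]; first by rewrite mul0r addr0.
rewrite /series_exp !iterS !mulE -!/(series_exp _ _) IH a0 b0 !series_exp0 //.
have -> : \sum_(i < n) a i.+1 * series_exp a k (n - i)%N =
          \sum_(i < n) b i.+1 * series_exp b k (n - i)%N.
  apply: eq_bigr => i _; rewrite ab ?ltnS //.
  congr (_ * _); apply: eq_series_exp => j jn.
  by apply: ab; apply: leq_ltn_trans jn _; rewrite ltnS leq_subr.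
rewrite -[k.+1%:R]natr1.
ring.
Qed.

Lemma A088221_unique a b : is_A088221 a -> is_A088221 b -> a =1 b.
Proof.
move=> [a0 Ha] [b0 Hb] n; elim/ltn_ind: n => -[|n] IH; first by rewrite a0 b0.
have := series_exp_diff n.+1 (ltn0Sn n) a0 IH; rewrite Ha Hb -[LHS]addr0.
move/addrI/esym/eqP; rewrite mulf_eq0 subr_eq0 => /orP[|/eqP //].
by rewrite Num.Theory.pnatr_eq0.
Qed.

Lemma size_concat_seq s : tag (concat_seq s) = sumn [seq tag D | D <- s].
Proof. by elim: s => //= D s <-. Qed.

Lemma num_indecomposable1 : num_indecomposable 1 = 1%N.
Proof.
pose M : {set chord 1} := [set (ord0, ord_max)].
have chord1 (c : chord 1) : (c.1 < c.2)%N -> c = (ord0, ord_max).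
  case: c => -[[|[|i]] hi] [[|[|j]] hj] //= _; congr pair; exact: val_inj.
have PM : perfect_matching M.
  apply/perfect_matchingP; split=> [c|p]; first by rewrite inE => /eqP ->.
  exists (ord0, ord_max); last by move=> d; rewrite inE => /eqP.
  by rewrite inE eqxx; split=> //; case: p => -[|[|i]] hi.
apply/eqP/cards1P; exists (Diagram PM); apply/setP => D; rewrite !inE.
have -> : D = Diagram PM.
  apply: val_inj; have /perfect_matchingP[D1 D2] := valP D; apply/setP => c /=.
  rewrite inE; apply/idP/eqP => [/D1/chord1 //|->].
  by have [d [dD _] _] := D2 ord0; rewrite -(chord1 d (D1 d dD)).
rewrite eqxx; apply/asboolP => -[[|E [|F s]] [] //= _ /and3P[E0 F0 _]].
move/(congr1 tag); rewrite /= => e.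
by move: E0 F0 e; case: (tag E) => // x _; case: (tag F) => // y _; rewrite addnS.
Qed.

Lemma A088221_exists : exists a, is_A088221 a.
Proof.
pose next (s : seq rat) : rat :=
  ((num_indecomposable (size s).+1)%:R - series_exp (nth 0 s) (size s) (size s))
  / (size s)%:R.
pose S n := iter n (fun s => rcons s (next s)) [:: 1].
have sizeS n : size (S n) = n.+1 by elim: n => //= n IH; rewrite size_rcons IH.
have nthS i n : (i <= n)%N -> (S n)`_i = (S i)`_i.
  elim: n => [|n IH]; first by rewrite leqn0 => /eqP ->.
  rewrite leq_eqVlt ltnS => /orP[/eqP -> //|le_in].
  by rewrite /= nth_rcons sizeS ltnS le_in IH.
exists (fun n => (S n)`_n); split=> // -[|n].
  by rewrite num_indecomposable1.
rewrite (@series_exp_diff _ (nth 0 (S n))) //; last first.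
  by move=> i; rewrite ltnS => /nthS.
rewrite /= nth_rcons sizeS ltnn eqxx [(S n)`_n.+1]nth_default ?sizeS // subr0.
by rewrite /next sizeS mulrC divfK ?Num.Theory.pnatr_eq0 // addrC subrK.
Qed.

(* Main.v *)
Require Import Defs.
From mathcomp Require Import all_boot all_order all_algebra.
From mathcomp Require Import boolp.
From mathcomp Require Import ring zify.

Set Implicit Arguments.
Unset Strict Implicit.
Unset Printing Implicit Defensive.

Import GRing.Theory Num.Theory.

(* Index all series by the number of points instead of chords: let [M], [K] and
   [2 - E] be the generating series of all, of connected-or-empty and of
   indecomposable diagrams. Three decompositions relate them:
   - opening the chord of the first point gives [M = 1 + z^2 M + z^3 M'];
   - splitting off the first block gives [M E = 1];
   - the component of the first point is a connected diagram, each of whose points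
     is followed by a gap that holds an arbitrary diagram, so [M(z) = K(z M(z))].
   By Lagrange inversion the last one yields [[z^N] K^N = [z^N] (1 + z M'/M)], and by
   the first two [1 + z M' E = (1 - E) / z^2], whose coefficient of [z^N] counts the
   indecomposable diagrams on [N + 2] points. For [N = 2n] this says that the square
   of the series of connected diagrams satisfies the equation defining A088221. *)

(** * Perfect matchings as involutions *)

Lemma card_bij (T1 T2 : finType) (A : {set T1}) (B : {set T2}) f g :
  {in A, forall x, f x \in B} -> {in B, forall y, g y \in A} ->
  {in A, cancel f g} -> {in B, cancel g f} -> #|A| = #|B|.
Proof.
move=> fB gA fK gK; apply/eqP; rewrite eqn_leq; apply/andP; split.
  rewrite -(card_in_imset (can_in_inj fK)); apply: subset_leq_card.
  by apply/subsetP => _ /imsetP[x xA ->]; apply: fB.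
rewrite -(card_in_imset (can_in_inj gK)); apply: subset_leq_card.
by apply/subsetP => _ /imsetP[x xA ->]; apply: gA.
Qed.

(** [R i x] reads: [i] is the index of [x]. A relation instead of a function suits indices found by
    a minimality or maximality argument. *)
Lemma sum_by_index (T I : finType) (A : pred T) (R : I -> pred T) (F : T -> nat) :
  (forall x, A x -> exists2 i, R i x & forall j, R j x -> j = i) ->
  \sum_(x | A x) F x = \sum_i \sum_(x | A x && R i x) F x.
Proof.
move=> uniqR; rewrite (exchange_big_dep A) /=; last by move=> i x _ /andP[].
apply: eq_bigr => x Ax; have [i Ri Rj] := uniqR x Ax.
rewrite (big_pred1 i) // => j; rewrite Ax /=.
by apply/idP/eqP => [/Rj //|->].
Qed.

Lemma card_by_index (T I : finType) (A : {set T}) (R : I -> pred T) :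
  (forall x, x \in A -> exists2 i, R i x & forall j, R j x -> j = i) ->
  #|A| = \sum_i #|[set x in A | R i x]|.
Proof.
move=> uniqR; rewrite -sum1_card (sum_by_index _ uniqR).
by apply: eq_bigr => i _; rewrite -sum1_card; apply: eq_bigl => x; rewrite inE.
Qed.

Section Matchings.
Variable T : finType.
Implicit Types (S A : {set T}) (f g h : {ffun T -> T}) (x y : T).

(** A matching of [S] is an involution of the whole type whose fixed points form the complement of
    [S]. Matchings of different subsets thus share one type. *)
Definition matching_on S f : bool :=
  [forall x, (f (f x) == x) && ((f x == x) == (x \notin S))].

Definition matchings S (P : pred {ffun T -> T}) : {set {ffun T -> T}} :=
  [set f | matching_on S f && P f].

Definition restrict S f : {ffun T -> T} := [ffun x => if x \in S then f x else x].

Definition stable A f : bool := [forall x in A, f x \in A].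

Lemma matching_onP S f :
  reflect (involutive f /\ forall x, (f x == x) = (x \notin S)) (matching_on S f).
Proof.
apply: (iffP forallP) => [H|[H1 H2] x]; last by rewrite H1 H2 !eqxx.
by split=> x; have /andP[/eqP ? /eqP ?] := H x.
Qed.

Lemma matching_out S f x : matching_on S f -> x \notin S -> f x = x.
Proof. by case/matching_onP=> _ H; rewrite -H => /eqP. Qed.

Lemma matching_in S f x : matching_on S f -> x \in S -> f x \in S.
Proof.
case/matching_onP=> fK fx xS; apply: contraT; rewrite -fx fK => /eqP e.
by have := fx x; rewrite -e eqxx xS.
Qed.

Lemma stableP A f : reflect (forall x, x \in A -> f x \in A) (stable A f).
Proof. exact: (iffP forall_inP). Qed.

Lemma stable_involutive A f x : involutive f -> stable A f -> (f x \in A) = (x \in A).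
Proof.
by move=> fK /stableP fA; apply/idP/idP => [/fA|/fA //]; rewrite fK.
Qed.

Lemma matching_restrict S A f :
  matching_on S f -> A \subset S -> stable A f -> matching_on A (restrict A f).
Proof.
move=> Sf /subsetP AS Af; have /matching_onP[fK fx] := Sf.
apply/matching_onP; split=> x; rewrite !ffunE; case: (boolP (x \in A)) => xA.
- by rewrite (stable_involutive _ fK Af) xA fK.
- by rewrite (negbTE xA).
- by rewrite fx (AS _ xA).
- by rewrite eqxx.
Qed.

(** Stability of [S1] forces stability of [S2], so [f] amounts to its two restrictions. This is the
    product rule behind all the decompositions below. *)
Lemma card_matchings_glue S1 S2 (P1 P2 : pred {ffun T -> T}) : [disjoint S1 & S2] ->
  #|[set f | [&& matching_on (S1 :|: S2) f, stable S1 f,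
                P1 (restrict S1 f) & P2 (restrict S2 f)]]|
  = #|matchings S1 P1| * #|matchings S2 P2|.
Proof.
move=> S12; rewrite -cardsX.
have dis x : x \in S1 -> x \in S2 -> False.
  by move=> x1 x2; have := disjointFr S12 x1; rewrite x2.
(* Composition glues because each factor is the identity on the support of the other. *)
pose glue (u : {ffun T -> T} * {ffun T -> T}) : {ffun T -> T} := [ffun x => u.1 (u.2 x)].
have glueK1 h g : matching_on S1 h -> matching_on S2 g -> restrict S1 (glue (h, g)) = h.
  move=> Hh Hg; apply/ffunP => x; rewrite !ffunE; case: ifPn => x1 /=.
    by rewrite (matching_out Hg) //; apply/negP => /(dis x x1).
  by rewrite (matching_out Hh x1).
have glueK2 h g : matching_on S1 h -> matching_on S2 g -> restrict S2 (glue (h, g)) = g.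
  move=> Hh Hg; apply/ffunP => x; rewrite !ffunE; case: ifPn => x2 /=.
    rewrite (matching_out Hh) //; apply/negP => gx1; exact: dis gx1 (matching_in Hg x2).
  by rewrite (matching_out Hg x2).
have st2 f : matching_on (S1 :|: S2) f -> stable S1 f -> stable S2 f.
  move=> fS f1; apply/stableP => x x2.
  have := matching_in fS (_ : x \in S1 :|: S2); rewrite !inE x2 orbT => /(_ isT).
  rewrite (stable_involutive _ _ f1); last by have /matching_onP[] := fS.
  by case/orP => // /dis /(_ x2).
apply: (@card_bij _ _ _ _ (fun f => (restrict S1 f, restrict S2 f)) glue) => /=.
- move=> f; rewrite !inE => /and4P[fS f1 -> ->]; rewrite !andbT /=.
  rewrite (matching_restrict fS) ?subsetUl //=.
  by rewrite (matching_restrict fS) ?subsetUr //; apply: st2.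
- move=> [h g]; rewrite !inE /= => /andP[/andP[Hh h1] /andP[Hg g2]].
  rewrite glueK1 // glueK2 // h1 g2 !andbT; apply/andP; split; last first.
    apply/stableP => x x1; rewrite ffunE /= (matching_out Hg) ?(matching_in Hh) //.
    by apply/negP => /(dis x x1).
  have /matching_onP[hK hx] := Hh; have /matching_onP[gK gx] := Hg.
  apply/matching_onP; split=> x; rewrite !ffunE /=.
    case: (boolP (x \in S2)) => x2.
      have g2x := matching_in Hg x2.
      by rewrite (matching_out Hh (x := g x)) ?gK ?(matching_out Hh) //;
        apply/negP => /dis; apply.
    rewrite (matching_out Hg x2) (matching_out Hg) ?hK //.
    case: (boolP (x \in S1)) => x1; last by rewrite (matching_out Hh x1).
    by apply/negP => /(dis _ (matching_in Hh x1)).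
  rewrite inE negb_or; case: (boolP (x \in S2)) => x2.
    rewrite (matching_out Hh) ?gx ?x2 ?andbF //.
    by apply/negP => /dis; apply; apply: matching_in.
  by rewrite (matching_out Hg x2) hx andbT.
- move=> f; rewrite inE => /and4P[fS f1 _ _]; apply/ffunP => x.
  rewrite !ffunE /=; have f2 := st2 f fS f1.
  have /matching_onP[fK _] := fS.
  case: (boolP (x \in S2)) => x2; last first.
    case: ifPn => // x1; rewrite (matching_out fS) // inE negb_or x1 x2 //.
  case: ifPn => // /dis []; exact: (stableP _ _ f2).
- move=> [h g]; rewrite !inE /= => /andP[/andP[Hh _] /andP[Hg _]].
  by rewrite glueK1 ?glueK2.
Qed.

Lemma eq_matchings S P Q :
  (forall f, matching_on S f -> P f = Q f) -> matchings S P = matchings S Q.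
Proof. by move=> PQ; apply/setP => f; rewrite !inE; case: (boolP (matching_on S f)) => // /PQ. Qed.

End Matchings.

(** * Transport of matchings along an injection *)

Section Transport.
Variables (T1 T2 : finType) (j : T2 -> T1).
Hypothesis j_inj : injective j.

Definition push (g : {ffun T2 -> T2}) : {ffun T1 -> T1} :=
  [ffun x => if [pick y | j y == x] is Some y then j (g y) else x].

Lemma pushE g y : push g (j y) = j (g y).
Proof.
rewrite ffunE; case: pickP => [z /eqP /j_inj -> //|/(_ y)]; by rewrite eqxx.
Qed.

Lemma push_out g x : x \notin codom j -> push g x = x.
Proof.
move=> xj; rewrite ffunE; case: pickP => // y /eqP e.
by rewrite -e codom_f in xj.
Qed.

Lemma card_matchings_push S P Q : S = [set j y | y in T2] ->
  (forall g, matching_on [set: T2] g -> P (push g) = Q g) ->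
  #|matchings S P| = #|matchings [set: T2] Q|.
Proof.
move=> -> PQ.
(* The default [y] is never reached when [f] is a matching of the image of [j], since [f (j y)] then
   lies in that image. *)
pose pull (f : {ffun T1 -> T1}) : {ffun T2 -> T2} :=
  [ffun y => if [pick z | j z == f (j y)] is Some z then z else y].
have pullE f y : matching_on [set j y | y in T2] f -> j (pull f y) = f (j y).
  move=> Hf; rewrite ffunE; case: pickP => [z /eqP //|N].
  have /imsetP[z _ e] := matching_in Hf (imset_f j (erefl : y \in T2)).
  by have := N z; rewrite e eqxx.
have outS x : (x \in [set j y | y in T2]) = (x \in codom j).
  by apply/imsetP/codomP => [[y _ ->]|[y ->]]; exists y.
have pullK f : matching_on [set j y | y in T2] f -> push (pull f) = f.
  move=> Hf; apply/ffunP => x; case: (boolP (x \in codom j)) => [/codomP[y ->]|xj].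
    by rewrite pushE pullE.
  by rewrite push_out // (matching_out Hf) // outS.
have pull_matching f : matching_on [set j y | y in T2] f -> matching_on [set: T2] (pull f).
  move=> Hf; have /matching_onP[fK fx] := Hf.
  apply/matching_onP; split=> y; first by apply: j_inj; rewrite !pullE ?fK.
  by rewrite -(inj_eq j_inj) pullE // fx imset_f ?inE.
apply: (@card_bij _ _ _ _ pull push).
- move=> f; rewrite !inE => /andP[Hf Pf]; rewrite pull_matching //=.
  by rewrite -PQ ?pull_matching // pullK.
- move=> g; rewrite !inE => /andP[Hg Qg]; rewrite PQ // Qg andbT.
  have /matching_onP[gK gx] := Hg; apply/matching_onP; split=> x.
    case: (boolP (x \in codom j)) => [/codomP[y ->]|xj]; first by rewrite !pushE gK.
    by rewrite !push_out.
  rewrite outS; case: (boolP (x \in codom j)) => [/codomP[y ->]|xj].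
    by rewrite pushE (inj_eq j_inj) gx !inE.
  by rewrite push_out // eqxx.
- by move=> f; rewrite inE => /andP[Hf _]; apply: pullK.
- move=> g _; apply/ffunP => y; rewrite ffunE pushE.
  by case: pickP => [z /eqP /j_inj //|/(_ (g y))]; rewrite eqxx.
Qed.

End Transport.

(** * The number of matchings *)

Definition num_matchings n := #|matchings [set: 'I_n] predT|.

Lemma card_matchings (T : finType) (S : {set T}) : #|matchings S predT| = num_matchings #|S|.
Proof.
apply: (card_matchings_push (j := @enum_val T (mem S))) => //; first exact: enum_val_inj.
apply/setP => x; apply/idP/imsetP => [xS|[y _ ->]]; last exact: enum_valP.
by exists (enum_rank_in xS x) => //; rewrite enum_rankK_in.
Qed.

Lemma num_matchings0 : num_matchings 0 = 1.
Proof.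
apply/eqP/cards1P; exists [ffun x => x]; apply/setP => f; rewrite !inE.
have -> : f = [ffun x => x] by apply/ffunP => -[].
by rewrite eqxx andbT; apply/forallP => -[].
Qed.

Lemma num_matchings1 : num_matchings 1 = 0.
Proof.
apply: eq_card0 => f; rewrite !inE andbT; apply/negP => /matching_onP[_ /(_ ord0)].
by rewrite !inE [f _]ord1 eqxx.
Qed.

Lemma card_matchings_pair (T : finType) (r s : T) : r != s ->
  #|matchings [set r; s] predT| = 1.
Proof.
move=> rs; apply/eqP/cards1P.
exists [ffun x => if x == r then s else if x == s then r else x].
apply/setP => f; rewrite !inE andbT; apply/idP/eqP => [Hf|->].
  have fr : f r = s.
    have := matching_in Hf (set21 r s); rewrite !inE => /orP[|/eqP //].
    by have /matching_onP[_ ->] := Hf; rewrite !inE eqxx.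
  apply/ffunP => x; rewrite !ffunE; case: eqVneq => [-> //|xr].
  case: eqVneq => [->|xs]; first by rewrite -fr; have /matching_onP[->] := Hf.
  by rewrite (matching_out Hf) // !inE negb_or xr.
have sr : (s == r) = false by rewrite eq_sym; apply: negbTE.
apply/matching_onP; split=> x; rewrite !ffunE ?inE ?negb_or.
  case: (eqVneq x r) => [->|xr]; first by rewrite sr eqxx.
  by case: (eqVneq x s) => [->|xs]; rewrite ?eqxx // (negbTE xr) (negbTE xs).
case: (eqVneq x r) => [->|xr]; first by rewrite sr.
by case: (eqVneq x s) => [->|xs]; rewrite ?eqxx // (negbTE rs).
Qed.

(** The matchings are sorted by the partner [s] of the first point; the other [n] points are matched
    freely. *)
Lemma num_matchingsSS n : num_matchings n.+2 = n.+1 * num_matchings n.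
Proof.
rewrite {1}/num_matchings.
rewrite (@card_by_index _ _ _ (fun s (f : {ffun 'I_n.+2 -> 'I_n.+2}) => f ord0 == s)); last first.
  by move=> f _; exists (f ord0) => // j /eqP.
rewrite (bigD1 ord0) //= eq_card0 ?add0n; last first.
  move=> f; rewrite !inE andbT; apply/negP => /andP[/matching_onP[_ ->]].
  by rewrite in_setT.
rewrite (eq_bigr (fun=> num_matchings n)) => [|s s0].
  rewrite sum_nat_const; congr (_ * _).
  by have := cardC1 (ord0 : 'I_n.+2); rewrite card_ord.
have <- : num_matchings #|~: [set ord0; s]| = num_matchings n.
  have := cardsC [set ord0; s]; rewrite cards2 eq_sym s0 card_ord => e.
  by have -> : #|~: [set ord0; s]| = n by lia.
(* The factor 1 becomes the number of matchings of the pair formed by [ord0] and [s]; stability of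
   this pair means exactly [f ord0 = s]. *)
rewrite -card_matchings -[RHS]mul1n -(@card_matchings_pair _ ord0 s); last by rewrite eq_sym.
rewrite -card_matchings_glue -?setI_eq0 ?setICr //; congr #|pred_of_set _|.
apply/setP => f; rewrite !inE !andbT setUCr; case: (boolP (matching_on _ _)) => //= Hf.
have /matching_onP[fK fx] := Hf.
apply/eqP/stableP => [<- x|/(_ ord0)].
  by rewrite !inE => /orP[] /eqP ->; rewrite ?fK eqxx ?orbT.
by rewrite !inE eqxx fx inE => /(_ isT)/eqP.
Qed.

Lemma num_matchings_odd n : odd n -> num_matchings n = 0.
Proof.
elim/ltn_ind: n => -[|[|n]] //= IH; first by rewrite num_matchings1.
by rewrite negbK num_matchingsSS => /IH -> //; rewrite muln0.
Qed.

(** * Decomposition at the first closed prefix *)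

Definition below n p : {set 'I_n} := [set x : 'I_n | x < p].

Lemma card_below n p : p <= n -> #|below n p| = p.
Proof.
move=> pn; have -> : below n p = [set widen_ord pn x | x in 'I_p].
  apply/setP => x; rewrite inE; apply/idP/imsetP => [xp|[y _ ->]]; last exact: (ltn_ord y).
  by exists (Ordinal xp) => //; apply: val_inj.
rewrite card_imset ?card_ord //.
by move=> x y /(congr1 val) e; apply: val_inj.
Qed.

(** Only proper nonempty prefixes are tested, as [0 < q < p]. This is the counterpart of
    indecomposability, on points. *)
Definition no_stable_prefix n p (f : {ffun 'I_n -> 'I_n}) : bool :=
  [forall q : 'I_p, (0 < q) ==> ~~ stable (below n q) f].

Definition num_prefix_free n := #|matchings [set: 'I_n] (@no_stable_prefix n n)|.

Lemma card_prefix_free n p : p <= n ->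
  #|matchings (below n p) (no_stable_prefix p)| = num_prefix_free p.
Proof.
move=> pn; have widen_inj : injective (widen_ord pn).
  by move=> x y /(congr1 val) e; apply: val_inj.
apply: (card_matchings_push widen_inj).
  apply/setP => x; rewrite inE; apply/idP/imsetP => [xp|[y _ ->]]; last exact: (ltn_ord y).
  by exists (Ordinal xp) => //; apply: val_inj.
move=> g _; apply: eq_forallb => q; congr (_ ==> ~~ _).
apply/stableP/stableP => H x.
  by have := H (widen_ord pn x); rewrite pushE // !inE.
rewrite inE => xq; have xp := ltn_trans xq (ltn_ord q).
have -> : x = widen_ord pn (Ordinal xp) by apply: val_inj.
by rewrite pushE // inE; have := H (Ordinal xp); rewrite !inE; apply.
Qed.

(** The shortest nonempty stable prefix, of length [i.+1], carries a matching without shorter stable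
    prefix, and the points after it are matched freely. *)
Lemma num_matchings_prefix n : 0 < n ->
  num_matchings n = \sum_(i < n) num_prefix_free i.+1 * num_matchings (n - i.+1).
Proof.
move=> n0; rewrite {1}/num_matchings.
pose R (i : 'I_n) (f : {ffun 'I_n -> 'I_n}) :=
  stable (below n i.+1) f && no_stable_prefix i.+1 f.
rewrite (@card_by_index _ _ _ R); last first.
  move=> f _; have ex : exists i : nat, (i < n) && stable (below n i.+1) f.
    (* The set of all points is a stable prefix, so a shortest one exists. *)
    exists n.-1; rewrite prednK // leqnn /=.
    by apply/stableP => x _; rewrite inE.
  case: (ex_minnP ex) => i /andP[lt_in st_i] min_i.
  exists (Ordinal lt_in); rewrite /R /=.
    rewrite st_i; apply/forallP => -[[|q] //= qi].
    by apply/negP => st_q; have := min_i q; rewrite st_q andbT; lia.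
  move=> j /andP[st_j /forallP no_j]; apply: val_inj => /=.
  have := min_i j; rewrite ltn_ord st_j => /(_ isT) le_ij.
  apply/eqP; rewrite eqn_leq le_ij andbT leqNgt; apply/negP => lt_ij.
  have /= := no_j (Ordinal (lt_ij : i.+1 < j.+1)).
  by rewrite st_i.
apply: eq_bigr => i _.
rewrite -(@card_prefix_free n) //.
have <- : num_matchings #|~: below n i.+1| = num_matchings (n - i.+1).
  have := cardsC (below n i.+1); rewrite card_below // card_ord => e.
  by have -> : #|~: below n i.+1| = n - i.+1 by lia.
rewrite -card_matchings -card_matchings_glue -?setI_eq0 ?setICr //.
congr #|pred_of_set _|; apply/setP => f; rewrite !inE !andbT setUCr /R.
congr (_ && _); case: (boolP (stable _ _)) => //= st.
apply: eq_forallb => q; congr (_ ==> ~~ _).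
apply/stableP/stableP => H x /[dup] + /H; rewrite !ffunE !inE => xq.
  by rewrite ifT //; apply: ltn_trans xq (ltn_ord q).
by rewrite ifT //; apply: ltn_trans xq (ltn_ord q).
Qed.

(** * Decomposition at the component of the first point *)

Definition between (a b z : nat) : bool := (a < z < b) || (b < z < a).

Section Crossings.
Variable n : nat.
Implicit Types (S T A : {set 'I_n}) (f g : {ffun 'I_n -> 'I_n}) (x y : 'I_n).

(* The chord at [x] separates the two ends of the chord at [y]. *)
Definition crosses f x y : bool := between x (f x) y != between x (f x) (f y).

Definition crossing_closed f A : bool :=
  [forall x in A, (f x \in A) && [forall y, crosses f x y ==> (y \in A)]].

(** Connectivity is stated on sets of points, without paths. The empty matching satisfies it
    vacuously, in accordance with the empty diagram being allowed. *)
Definition connected_on S f : bool :=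
  [forall A : {set 'I_n}, [&& A \subset S, A != set0 & crossing_closed f A] ==> (A == S)].

Lemma crossing_closedP f A :
  reflect (forall x, x \in A -> f x \in A /\ forall y, crosses f x y -> y \in A)
          (crossing_closed f A).
Proof.
apply: (iffP forall_inP) => H x /H.
  by case/andP=> fx /forallP H'; split=> // y; apply/implyP.
by case=> -> H' /=; apply/forallP => y; apply/implyP/H'.
Qed.

Lemma connected_onP S f :
  reflect (forall A, A \subset S -> A != set0 -> crossing_closed f A -> A = S)
          (connected_on S f).
Proof.
apply: (iffP forallP) => H A.
  by move=> AS A0 cA; apply/eqP; have := H A; rewrite AS A0 cA.
by apply/implyP => /and3P[AS A0 cA]; apply/eqP/H.
Qed.

Lemma crosses_fixed f x y : f y = y -> crosses f x y = false.
Proof. by move=> fy; rewrite /crosses fy eqxx. Qed.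

Lemma crosses_fixedl f x y : f x = x -> crosses f x y = false.
Proof. by move=> fx; rewrite /crosses fx /between; apply/negbTE/negPn/eqP; lia. Qed.

Lemma crosses_sym f x y : involutive f -> crosses f x y = crosses f y x.
Proof.
move=> fK.
case: (eqVneq (f x) x) => [e|fx]; first by rewrite (crosses_fixedl _ e) (crosses_fixed _ e).
case: (eqVneq (f y) y) => [e|fy]; first by rewrite (crosses_fixedl _ e) (crosses_fixed _ e).
case: (eqVneq y x) => [->|yx] //.
case: (eqVneq y (f x)) => [->|yfx].
  by rewrite /crosses fK /between; congr (_ != _); lia.
(* From here on the four ends are distinct, and the symmetry is a fact about the order of four
   numbers. *)
have fyx : f y != x by rewrite -[x]fK (inj_eq (can_inj fK)).
have fyfx : f y != f x by rewrite (inj_eq (can_inj fK)).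
move: fx fy yx yfx fyx fyfx; rewrite -!val_eqE /crosses /between /=.
lia.
Qed.

Lemma crosses_partner f x y : involutive f -> crosses f x (f y) = crosses f x y.
Proof. by move=> fK; rewrite /crosses fK eq_sym. Qed.

(** Both taking partners and crossing are symmetric, so no link leads from a point outside [B] into
    [B]. *)
Lemma crossing_closedD f A B : involutive f ->
  crossing_closed f A -> crossing_closed f B -> crossing_closed f (A :\: B).
Proof.
move=> fK /crossing_closedP cA /crossing_closedP cB; apply/crossing_closedP => x.
rewrite !inE => /andP[xB /cA[fxA cxA]]; rewrite fxA; split.
  by rewrite andbT; apply: contra xB => /cB[]; rewrite fK.
move=> y cxy; rewrite inE cxA // andbT; apply: contra xB => /cB[_]; apply.
by rewrite crosses_sym.
Qed.

End Crossings.

Definition num_connected_matchings n := #|matchings [set: 'I_n] (connected_on [set: 'I_n])|.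

(** The enumeration of a set of ordinals is increasing; hence transport along it preserves
    crossings, which depend on the order only. *)
Lemma enum_val_mono n (S : {set 'I_n}) :
  {mono @enum_val _ (mem S) : i j / (i < j)%N >-> (i < j)%N}.
Proof.
have sorted_S : sorted ltn (map val (enum S)).
  have -> : enum S = filter (mem S) (enum 'I_n).
    by rewrite {1}/enum_mem -enumT; apply: eq_filter => x.
  rewrite sorted_map; apply: sorted_filter; first by move=> x y z /= ; apply: ltn_trans.
  by rewrite -sorted_map val_enum_ord iota_ltn_sorted.
have nthE (i : 'I_#|S|) : val (enum_val i) = nth 0 (map val (enum S)) i.
  rewrite (nth_map (enum_val i)) -?cardE // /enum_val; congr val.
  by apply: set_nth_default; rewrite -cardE.
have mono_lt (i j : 'I_#|S|) : i < j -> enum_val i < enum_val j.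
  move=> ij; rewrite !nthE; apply: (sorted_ltn_nth ltn_trans) => //;
  by rewrite inE size_map -cardE.
move=> i j; case: (ltngtP i j) => [/mono_lt //|/mono_lt|/val_inj ->]; last by rewrite ltnn.
by move=> ji; apply/negbTE; rewrite -leqNgt ltnW.
Qed.

Lemma card_connected n (S : {set 'I_n}) :
  #|matchings S (connected_on S)| = num_connected_matchings #|S|.
Proof.
have j_inj := @enum_val_inj _ (mem S); have j_mono := @enum_val_mono n S.
set j := @enum_val _ _ in j_inj j_mono.
have jS y : j y \in S by apply: enum_valP.
have inS x : x \in S -> exists y, x = j y.
  by move=> xS; exists (enum_rank_in xS x); rewrite /j enum_rankK_in.
have SE : S = [set j y | y in 'I_#|S|].
  apply/setP => x; apply/idP/imsetP => [/inS[y ->]|[y _ ->]]; [by exists y | exact: jS].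
apply: (card_matchings_push j_inj) => // g Hg.
have crossE x y : crosses (push j g) (j x) (j y) = crosses g x y.
  by rewrite /crosses /between !pushE // !j_mono.
have fixE x : x \notin S -> push j g x = x.
  move=> xS; rewrite push_out //; apply: contra xS => /codomP[y ->]; exact: jS.
have closedE (B : {set 'I_#|S|}) :
    crossing_closed (push j g) [set j y | y in B] = crossing_closed g B.
  apply/crossing_closedP/crossing_closedP => H.
    move=> x xB; have [] := H (j x) (imset_f _ xB).
    rewrite pushE // mem_imset // => gxB cx; split=> // y.
    by rewrite -crossE => /cx; rewrite mem_imset.
  move=> _ /imsetP[x xB ->]; have [gxB cx] := H x xB.
  rewrite pushE // mem_imset //; split=> // y.
  case: (boolP (y \in S)) => [|/fixE /crosses_fixed -> //].
  by case/inS=> z ->; rewrite crossE mem_imset //; apply: cx.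
apply/connected_onP/connected_onP => H.
  move=> B _ B0; rewrite -closedE => cB.
  have BS : [set j y | y in B] = S.
    apply: H cB; first by apply/subsetP => _ /imsetP[y _ ->].
    by rewrite imset_eq0.
  apply/setP => y; rewrite inE -(mem_imset B _ j_inj); rewrite BS; exact: jS.
move=> A /subsetP AS A0.
(* Any subset of [S] is the image of its preimage, which makes [closedE] applicable to it. *)
have AE : A = [set j y | y in [set y | j y \in A]].
  apply/setP => x; apply/idP/imsetP => [xA|[y + ->]]; last by rewrite inE.
  by have [y e] := inS x (AS x xA); exists y; rewrite // inE -e.
rewrite AE closedE => /H -> //; last first.
  by apply: contraNneq A0 => e; rewrite AE e imset0.
by apply/setP => x; apply/imsetP/idP => [[y _ ->] //|/inS[y ->]]; exists y.
Qed.

Lemma num_connected_matchings0 : num_connected_matchings 0 = 1.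
Proof.
rewrite -num_matchings0 /num_matchings /num_connected_matchings.
rewrite (@eq_matchings _ _ _ predT) // => f _; apply/connected_onP => A _.
by case/set0Pn=> -[].
Qed.

Section Components.
Variable n : nat.
Implicit Types (S T A : {set 'I_n}) (f g : {ffun 'I_n -> 'I_n}) (r x y t : 'I_n).

(** The component is the intersection of all crossing-closed sets that contain [r]. *)
Definition component f r : {set 'I_n} :=
  [set y | [forall A : {set 'I_n}, crossing_closed f A && (r \in A) ==> (y \in A)]].

(** No chord of [g] passes over a point of [T]: its two ends lie in the same gap left by [T]. *)
Definition respects_gaps T g : bool := [forall t in T, forall x : 'I_n, (x < t) == (g x < t)].

Lemma respects_gapsP T g :
  reflect (forall t x, t \in T -> (x < t) = (g x < t)) (respects_gaps T g).
Proof.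
apply: (iffP forall_inP) => [H t x tT|H t tT].
  exact: (eqP (forallP (H t tT) x)).
by apply/forallP => x; rewrite (H t x tT).
Qed.

Lemma component_min f r A : crossing_closed f A -> r \in A -> component f r \subset A.
Proof.
move=> cA rA; apply/subsetP => y; rewrite inE => /forallP/(_ A).
by rewrite cA rA.
Qed.

Lemma mem_component f r : r \in component f r.
Proof. by rewrite inE; apply/forallP => A; apply/implyP => /andP[]. Qed.

Lemma component_closed f r : crossing_closed f (component f r).
Proof.
apply/crossing_closedP => x; rewrite inE => /forallP Hx.
have inx A : crossing_closed f A -> r \in A -> x \in A.
  by move=> cA rA; have := Hx A; rewrite cA rA.
split=> [|y cxy]; rewrite inE; apply/forallP => A; apply/implyP => /andP[cA rA];
  have [fxA cx] := crossing_closedP _ _ cA x (inx A cA rA) => //.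
exact: cx.
Qed.

(** A closed part containing [r] is everything by minimality. A nonempty closed part avoiding [r]
    could be removed, leaving a smaller closed set around [r]. *)
Lemma component_connected f r : involutive f ->
  connected_on (component f r) (restrict (component f r) f).
Proof.
move=> fK; set T := component f r.
have /crossing_closedP cT : crossing_closed f T := component_closed f r.
apply/connected_onP => A AT A0 /crossing_closedP cA.
have cfA : crossing_closed f A.
  apply/crossing_closedP => x xA; have xT := subsetP AT x xA.
  have [+ cx] := cA x xA; rewrite ffunE xT => fxA; split=> // y cxy.
  (* What crosses a point of the component lies in the component, so this crossing survives the
     restriction. *)
  apply: cx; have [_ /(_ y cxy) yT] := cT x xT.
  by rewrite /crosses !ffunE xT yT.
apply/eqP; rewrite eqEsubset AT /=; case: (boolP (r \in A)) => rA.
  exact: component_min.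
have [x xA] := set0Pn _ A0.
have := @component_min f r _ (crossing_closedD fK (component_closed f r) cfA).
rewrite in_setD rA mem_component => /(_ isT) /subsetP /(_ x (subsetP AT x xA)).
by rewrite inE xA.
Qed.

Lemma component_respects_gaps f r : involutive f -> r = 0 :> nat ->
  respects_gaps (component f r) (restrict (~: component f r) f).
Proof.
move=> fK r0; set T := component f r.
have /crossing_closedP cT : crossing_closed f T := component_closed f r.
apply/respects_gapsP => t x tT; rewrite ffunE inE; case: ifP => // xT.
have nfxT : f x \notin T by apply: contraNN xT => /cT[]; rewrite fK.
have ncross y : y \in T -> crosses f x y = false.
  move=> yT; rewrite crosses_sym //; apply/negbTE; apply: contraNN xT => cyx.
  by have [_] := cT y yT; apply.
have ne y : y \in T -> (y != x :> nat) /\ (y != f x :> nat).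
  by move=> yT; split; apply: contraTneq yT => /val_inj ->.
(* The chord at [x] is crossed by no chord of [T], so the points of [T] under it form a closed set.
   It omits [r], the first of all points, and by minimality of the component it is empty. *)
pose A := [set z in T | between x (f x) z].
have cA : crossing_closed f A.
  apply/crossing_closedP => z; rewrite inE => /andP[zT bz]; have [fzT cz] := cT z zT.
  have bfz : between x (f x) (f z).
    by have := ncross z zT; rewrite /crosses bz => /negbFE/eqP <-.
  rewrite inE fzT bfz; split=> // y czy; have yT := cz y czy.
  have [fyT _] := cT y yT.
  rewrite inE yT /=; have /negbFE/eqP := ncross y yT.
  move: bz bfz czy; have [] := ne y yT; have [] := ne _ fyT.
  by rewrite /crosses /between; lia.
have := @component_min f r _ (crossing_closedD fK (component_closed f r) cA).
have nbr : between x (f x) r = false by rewrite /between r0; lia.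
rewrite in_setD mem_component in_set nbr andbF => /(_ isT) /subsetP /(_ t tT).
rewrite in_setD tT in_set tT andbT /= /between; have [] := ne t tT; move: (nat_of_ord (f x)) (nat_of_ord x) (nat_of_ord t) => a b c; lia.
Qed.

Lemma component_eq f r T : matching_on [set: 'I_n] f -> r = 0 :> nat -> r \in T ->
  (component f r == T) =
  [&& stable T f, connected_on T (restrict T f) & respects_gaps T (restrict (~: T) f)].
Proof.
move=> Hf r0 rT; have /matching_onP[fK _] := Hf.
apply/eqP/and3P => [<-|[sT conT /respects_gapsP gapT]].
  split; [| exact: component_connected | exact: component_respects_gaps].
  apply/stableP => x xC; by have [] := crossing_closedP _ _ (component_closed f r) x xC.
(* A chord outside [T] has both ends in one gap of [T], hence crosses no chord of [T]. So [T] is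
   closed and contains the component. *)
have cT : crossing_closed f T.
  apply/crossing_closedP => x xT; have fxT := stableP _ _ sT x xT; split=> // y.
  apply: contraTT => yT; have fyT : f y \notin T by rewrite (stable_involutive _ fK sT).
  have := gapT x y xT; have := gapT (f x) y fxT; rewrite ffunE inE yT.
  have ne z : z \in T -> (z != y :> nat) /\ (z != f y :> nat).
    move=> zT; split; apply: contraNneq yT => e; first by rewrite -(val_inj e).
    by rewrite -(stable_involutive _ fK sT) -(val_inj e).
  have [] := ne x xT; have [] := ne _ fxT.
  rewrite /crosses /between; move: (nat_of_ord (f x)) (nat_of_ord (f y)) (nat_of_ord x) (nat_of_ord y) => a b c d; lia.
have /subsetP CT := component_min cT rT.
(* Conversely the component is a nonempty closed subset of [T], so connectivity of [T] makes them
   equal. *)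
move/connected_onP: conT; apply; first exact/subsetP.
  by apply/set0Pn; exists r; apply: mem_component.
have /crossing_closedP cC := component_closed f r.
apply/crossing_closedP => x xC; have [fxC cx] := cC x xC.
rewrite ffunE CT //; split=> // y.
case: (boolP (y \in T)) => yT; last by rewrite crosses_fixed // ffunE (negbTE yT).
by move=> H; apply: cx; move: H; rewrite /crosses !ffunE yT CT.
Qed.

Lemma num_matchings_component r : r = 0 :> nat ->
  num_matchings n =
  \sum_(T : {set 'I_n} | r \in T)
     num_connected_matchings #|T| * #|matchings (~: T) (respects_gaps T)|.
Proof.
move=> r0; rewrite {1}/num_matchings.
rewrite (@card_by_index _ _ _ (fun T f => component f r == T)); last first.
  by move=> f _; exists (component f r) => // T /eqP.
rewrite [RHS]big_mkcond; apply: eq_bigr => T _; case: ifPn => rT.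
  rewrite -card_connected -card_matchings_glue -?setI_eq0 ?setICr //.
  congr #|pred_of_set _|; apply/setP => f; rewrite !inE andbT setUCr.
  by case: (boolP (matching_on _ _)) => //= Hf; rewrite component_eq.
apply: eq_card0 => f; rewrite !inE; apply/negP => /andP[_ /eqP e].
by move: rT; rewrite -e mem_component.
Qed.

(** For [0 < p <= n] this says that [T] contains the first point; for [p = 0] it is vacuous, which
    lets the recurrence on [num_gapped] start from the empty set. *)
Definition rooted p T : bool := [forall x : 'I_n, (x < p) ==> [exists t in T, t <= x]].

(* The pairs [(T, g)] of a [k]-set [T] of points below [p], the first one included
   when [p > 0], and a matching [g] of the other points that does not cross [T]. *)
Definition num_gapped k p : nat :=
  \sum_(T : {set 'I_n} | [&& T \subset below n p, #|T| == k & rooted p T])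
     #|matchings (below n p :\: T) (respects_gaps T)|.

Lemma rootedP p T :
  reflect (forall x, x < p -> exists2 t, t \in T & t <= x) (rooted p T).
Proof.
apply: (iffP forallP) => H x.
  by move=> xp; have := H x; rewrite xp => /exists_inP.
by apply/implyP => /H H'; apply/exists_inP.
Qed.

(** With [t] the largest point of the set, no chord passes over [t]. The points after [t] are
    matched freely, because every point of the set precedes them. *)
Lemma card_matchings_last_gap p t T : p <= n -> t < p -> T \subset below n t ->
  #|matchings (below n p :\: (t |: T)) (respects_gaps (t |: T))| =
  #|matchings (below n t :\: T) (respects_gaps T)| * num_matchings (p - t.+1).
Proof.
move=> pn tp /subsetP Tt.
have Tlt x : x \in T -> x < t by move/Tt; rewrite inE.
pose S2 := below n p :\: below n t.+1.
have cardS2 : #|S2| = p - t.+1.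
  rewrite cardsD (setIidPr _) ?card_below //.
  by apply/subsetP => x; rewrite !inE => /leq_trans; apply.
rewrite -cardS2 -card_matchings.
set S1 := below n t :\: T.
have in1 x : (x \in S1) = (x \notin T) && (x < t) by rewrite !inE.
have in2 x : (x \in S2) = (t < x < p) by rewrite !inE -leqNgt.
have inS x : (x \in below n p :\: (t |: T)) = (x \in S1) || (x \in S2).
  rewrite in1 in2 !inE negb_or -val_eqE /=.
  by case: (boolP (x \in T)) => [/Tlt|_] /=; lia.
rewrite -card_matchings_glue; last first.
  rewrite -setI_eq0; apply/eqP/setP => x; rewrite in_setI in1 in2 in_set0.
  by case: (x \notin T) => //=; lia.
have -> : S1 :|: S2 = below n p :\: (t |: T) by apply/setP => x; rewrite inS inE.
congr #|pred_of_set _|; apply/setP => f; rewrite !inE andbT.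
case: (boolP (matching_on _ _)) => //= Hf; have /matching_onP[fK fx] := Hf.
apply/respects_gapsP/andP => [gap|[s1 /respects_gapsP gap]].
  split.
    apply/stableP => x x1.
    have := matching_in Hf (_ : x \in _); rewrite !inS x1 => /(_ isT) /orP[//|].
    rewrite in2 => /andP[tfx _]; move: x1; rewrite in1 (gap t x (setU11 _ _)) => /andP[_].
    by rewrite ltnNge (ltnW tfx).
  apply/respects_gapsP => s x sT; rewrite ffunE; case: ifP => // _.
  by apply: gap; rewrite inE sT orbT.
move=> s x; case: (boolP (x \in S1)) => x1.
  have fx1 := stableP _ _ s1 x x1.
  rewrite !inE => /orP[/eqP ->|sT]; first by move: x1 fx1; rewrite !in1 => /andP[_ ->] /andP[_ ->].
  by rewrite (gap s x sT) ffunE x1.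
case: (boolP (x \in S2)) => x2; last first.
  by rewrite (matching_out Hf) // inS negb_or x1.
have : f x \in S2.
  have := matching_in Hf (_ : x \in _); rewrite !inS x2 orbT => /(_ isT).
  by rewrite (stable_involutive _ fK s1) (negbTE x1).
move: x2; rewrite !in2 => /andP[tx _] /andP[tfx _] sT.
have st : s <= t by move: sT; rewrite !inE => /orP[/eqP ->|/Tlt /ltnW].
by rewrite !ltnNge (ltnW (leq_ltn_trans st tx)) (ltnW (leq_ltn_trans st tfx)).
Qed.

(** The largest point [t] of the set is removed together with the gap after it. This is the
    coefficient form of [(z M)^(k+1) = (z M)^k (z M)]. *)
Lemma num_gappedS k p : p <= n ->
  num_gapped k.+1 p = \sum_(t < p) num_gapped k t * num_matchings (p - t.+1).
Proof.
move=> pn; rewrite {1}/num_gapped.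
pose w := widen_ord pn.
pose R (t : 'I_p) (T : {set 'I_n}) := (w t \in T) && [forall s in T, s <= t].
rewrite (@sum_by_index _ _ _ R); last first.
  move=> T /and3P[/subsetP Tp /eqP cT _].
  have /set0Pn[t0 t0T] : T != set0 by rewrite -card_gt0 cT.
  case: (arg_maxnP (fun x : 'I_n => val x) t0T) => t tT tmax.
  have tp : t < p by have := Tp t tT; rewrite inE.
  exists (Ordinal tp).
    rewrite /R (_ : w _ = t); last exact: val_inj.
    by apply/andP; split; [exact: tT | apply/forall_inP => s /tmax].
  move=> j /andP[jT /forall_inP jmax]; apply: val_inj; apply/eqP.
  by rewrite eqn_leq; apply/andP; split; [exact: (tmax _ jT) | exact: (jmax _ tT)].
apply: eq_bigr => t _; rewrite /num_gapped big_distrl /=.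
rewrite (reindex_onto (fun T => w t |: T) (fun T => T :\ w t)) /=; last first.
  by move=> T /andP[_ /andP[tT _]]; rewrite setD1K.
have condE T : [&& w t |: T \subset below n p, #|w t |: T| == k.+1 & rooted p (w t |: T)]
    && R t (w t |: T) && ((w t |: T) :\ w t == T)
  = [&& T \subset below n t, #|T| == k & rooted t T].
  (* A set [T] that already contains [t] fails both sides: it is not below [t], and adding then
     removing [t] does not give it back. *)
  case: (boolP (w t \in T)) => tT.
    have -> : (T \subset below n t) = false.
      by apply/negP => /subsetP /(_ _ tT); rewrite inE ltnn.
    apply/negP => /andP[_ /eqP e]; by move: tT; rewrite -e !inE eqxx.
  rewrite setU1K // eqxx andbT cardsU1 tT eqSS /R setU11 /=.
  apply/andP/and3P => [[/and3P[_ -> /rootedP rT] /forall_inP maxt]|[/subsetP Tt -> /rootedP rT]].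
    split=> //.
      apply/subsetP => x xT; rewrite inE ltn_neqAle maxt ?inE ?xT ?orbT // andbT.
      by apply: contraNneq tT => e; rewrite (_ : w t = x) //; apply: val_inj.
    apply/rootedP => x xt; have [s + sx] := rT x (ltn_trans xt (ltn_ord t)).
    rewrite !inE => /orP[/eqP e|sT]; last by exists s.
    by move: sx; rewrite e /= leqNgt xt.
  split; first apply/and3P; first split=> //.
  - apply/subsetP => x; rewrite !inE => /orP[/eqP ->|/Tt]; first exact: (ltn_ord t).
    by rewrite inE => /ltn_trans; apply.
  - apply/rootedP => x xp; case: (ltnP x t) => [/rT[s sT sx]|tx].
      by exists s; rewrite // !inE sT orbT.
    by exists (w t); rewrite // setU11.
  - apply/forall_inP => s; rewrite !inE => /orP[/eqP -> //|/Tt].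
    by rewrite inE => /ltnW.
rewrite (eq_bigl _ _ condE); apply: eq_bigr => T /andP[Tt _].
by rewrite card_matchings_last_gap //=.
Qed.

Lemma num_gapped0 p : p <= n -> num_gapped 0 p = (p == 0).
Proof.
move=> pn; rewrite /num_gapped; case: p pn => [|p] pn.
  rewrite (big_pred1 set0) => [|T].
    rewrite setD0 (_ : below n 0 = set0); last by apply/setP => x; rewrite !inE.
    rewrite (@eq_matchings _ _ _ predT) ?card_matchings ?cards0 ?num_matchings0 //.
    by move=> f _; apply/respects_gapsP => t x; rewrite inE.
  rewrite cards_eq0 andbCA /=; case: (eqVneq T set0) => [->|_] //=.
  by rewrite sub0set; apply/rootedP.
rewrite big_pred0 // => T; rewrite cards_eq0 andbCA; case: (eqVneq T set0) => [->|] //=.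
rewrite sub0set; apply/negP => /rootedP /(_ (Ordinal pn)) [] // x; by rewrite inE.
Qed.

(** The possible components of the first point are grouped by their size [k]. This is the
    coefficient form of [M(z) = K(z M(z))]. *)
Lemma num_matchings_gapped :
  num_matchings n = \sum_(k < n.+1) num_connected_matchings k * num_gapped k n.
Proof.
have full : below n n = setT by apply/setP => x; rewrite !inE ltn_ord.
(* Without points there is no first point to take the component of. *)
case: (posnP n) => [n0|n0].
  rewrite n0 big_ord1 num_gapped0 ?n0 // num_connected_matchings0; exact: num_matchings0.
rewrite (@num_matchings_component (Ordinal n0)) //.
pose cardT (T : {set 'I_n}) : 'I_n.+1 := inord #|T|.
have cardTE T : cardT T = #|T| :> nat.
  by rewrite inordK // ltnS -[leqRHS]card_ord max_card.
rewrite (@sum_by_index _ _ _ (fun k T => cardT T == k)); last first.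
  by move=> T _; exists (cardT T) => // k /eqP.
apply: eq_bigr => k _; rewrite big_distrr /=.
apply: eq_big => [T|T /andP[_ /eqP <-]]; last by rewrite cardTE full setTD.
rewrite full subsetT /= -val_eqE /= cardTE andbC; congr (_ && _).
apply/idP/rootedP => [rT x _|/(_ (Ordinal n0) n0) [t tT]]; first by exists (Ordinal n0).
by rewrite leqn0 => /eqP e; rewrite (_ : Ordinal n0 = t) //; apply: val_inj.
Qed.

End Components.

(** * Diagrams as matchings *)

Lemma neq_ltn_ord m (p q : 'I_m) : (p != q) = (p < q) || (q < p).
Proof. exact: neq_ltn. Qed.

Section Partner.
Variable n : nat.
Implicit Types (M : {set chord n}) (c d : chord n) (f g : {ffun 'I_n.*2 -> 'I_n.*2}).

(** The default [p] serves totality only: in a perfect matching every point has a partner. *)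
Definition partner M : {ffun 'I_n.*2 -> 'I_n.*2} :=
  [ffun p => odflt p [pick q | ((p, q) \in M) || ((q, p) \in M)]].

Definition chords_of f : {set chord n} := [set c : chord n | (c.1 < c.2) && (f c.1 == c.2)].

Lemma partner_chord M c : perfect_matching M -> c \in M ->
  partner M c.1 = c.2 /\ partner M c.2 = c.1.
Proof.
move=> /perfect_matchingP[lt_M unique_M] cM.
have same p d : d \in M -> endpoint p c -> endpoint p d -> d = c.
  have [e _ He] := unique_M p; by move=> dM /(He c cM) -> /(He d dM) ->.
have c1 : endpoint c.1 c by rewrite /endpoint eqxx.
have c2 : endpoint c.2 c by rewrite /endpoint eqxx orbT.
split; rewrite ffunE; case: pickP => [q /orP[] qM | /(_ _)] /=.
- by have <- : (c.1, q) = c by apply: (same c.1); rewrite // /endpoint eqxx.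
- have e : (q, c.1) = c by apply: (same c.1); rewrite // /endpoint eqxx orbT.
  by have := lt_M c cM; rewrite -(congr1 snd e) ltnn.
- by move/(_ c.2); rewrite -surjective_pairing cM.
- have e : (c.2, q) = c by apply: (same c.2); rewrite // /endpoint eqxx.
  by have := lt_M c cM; rewrite -(congr1 fst e) ltnn.
- by have <- : (q, c.2) = c by apply: (same c.2); rewrite // /endpoint eqxx orbT.
- by move/(_ c.1); rewrite -surjective_pairing cM orbT.
Qed.

Lemma matching_partner M : perfect_matching M -> matching_on [set: 'I_n.*2] (partner M).
Proof.
move=> HM; have /perfect_matchingP[lt_M unique_M] := HM.
have cover p : exists2 c, c \in M & p = c.1 \/ p = c.2.
  have [c [cM /orP[] /eqP ->] _] := unique_M p; exists c => //; by [left | right].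
apply/matching_onP; split=> p; have [c cM pc] := cover p; have [e1 e2] := partner_chord HM cM.
  by case: pc => ->; rewrite ?e1 ?e2 ?e1.
have := lt_M c cM; rewrite inE -val_eqE.
by case: pc => ->; rewrite ?e1 ?e2 /=; lia.
Qed.

Lemma chords_of_partner M : perfect_matching M -> chords_of (partner M) = M.
Proof.
move=> HM; have /perfect_matchingP[lt_M unique_M] := HM.
apply/setP => c; rewrite inE; apply/andP/idP => [[lt_c /eqP pc]|cM]; last first.
  by rewrite (lt_M c cM); have [-> _] := partner_chord HM cM.
have [d [dM /orP[] /eqP e] _] := unique_M c.1; have [e1 e2] := partner_chord HM dM.
  suff -> : c = d by [].
  by rewrite [c]surjective_pairing [d]surjective_pairing -pc e e1.
by have := lt_M d dM; rewrite -e2 -e pc ltnNge ltnW.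
Qed.

Lemma perfect_matching_chords_of f : matching_on [set: 'I_n.*2] f ->
  perfect_matching (chords_of f).
Proof.
case/matching_onP => fK fx; apply/perfect_matchingP; split=> [c|p].
  by rewrite inE => /andP[].
have uniq_c c d : c \in chords_of f -> d \in chords_of f -> endpoint p c -> endpoint p d -> d = c.
  rewrite !inE => /andP[lt_c /eqP e_c] /andP[lt_d /eqP e_d] pc pd.
  rewrite [c]surjective_pairing [d]surjective_pairing -e_c -e_d.
  suff -> : d.1 = c.1 by [].
  move: pc pd lt_c lt_d; rewrite /endpoint -e_c -e_d.
  move=> /orP[] /eqP pc /orP[] /eqP pd.
  - by rewrite -pc.
  - by rewrite -pc pd fK => lt1 lt2; have := ltn_trans lt1 lt2; rewrite ltnn.
  - by rewrite -pd pc fK => lt1 lt2; have := ltn_trans lt1 lt2; rewrite ltnn.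
  - by rewrite pc in pd; move: pd => /(can_inj fK).
have : f p != p by rewrite fx inE.
rewrite neq_ltn_ord => /orP[lt_fp|lt_pf].
  exists (f p, p); last by move=> d dM; apply: uniq_c => //; rewrite ?inE /endpoint /= ?lt_fp ?fK ?eqxx ?orbT.
  by rewrite inE /endpoint /= lt_fp fK !eqxx orbT.
exists (p, f p); last by move=> d dM; apply: uniq_c => //; rewrite ?inE /endpoint /= ?lt_pf ?fK ?eqxx ?orbT.
by rewrite inE /endpoint /= lt_pf !eqxx.
Qed.

Lemma chords_of_inj f g : matching_on [set: 'I_n.*2] f -> matching_on [set: 'I_n.*2] g ->
  chords_of f = chords_of g -> f = g.
Proof.
case/matching_onP => fK fx /matching_onP[gK gx] efg; apply/ffunP => x.
have : f x != x by rewrite fx inE.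
rewrite neq_ltn_ord => /orP[lt_fx|lt_xf].
  have : (f x, x) \in chords_of g by rewrite -efg inE /= lt_fx fK eqxx.
  by rewrite inE /= => /andP[_ /eqP e]; rewrite -{2}e gK.
have : (x, f x) \in chords_of g by rewrite -efg inE /= lt_xf eqxx.
by rewrite inE /= => /andP[_ /eqP].
Qed.

(** [partner] and [chords_of] are inverse bijections between diagrams and involutions without fixed
    points. *)
Lemma card_diagrams (P : pred (diagram n)) (Q : pred {ffun 'I_n.*2 -> 'I_n.*2}) :
  (forall D, P D = Q (partner (chords D))) ->
  #|[set D | P D]| = #|matchings [set: 'I_n.*2] Q|.
Proof.
move=> PQ; have perf (D : diagram n) : perfect_matching (chords D) := valP D.
rewrite -(@card_in_imset _ _ (fun D : diagram n => partner (chords D))); last first.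
  move=> D E _ _ /(congr1 chords_of); rewrite !chords_of_partner //.
  exact: val_inj.
congr #|pred_of_set _|; apply/setP => f; rewrite inE; apply/imsetP/andP => [[D + ->]|[Hf Qf]].
  by rewrite inE PQ => QD; rewrite matching_partner.
have fE : f = partner (chords (Diagram (perfect_matching_chords_of Hf))).
  by apply: chords_of_inj => //; rewrite ?matching_partner ?chords_of_partner.
by exists (Diagram (perfect_matching_chords_of Hf)); rewrite // inE PQ -fE.
Qed.

Definition chord_at f (p : 'I_n.*2) : chord n := if p < f p then (p, f p) else (f p, p).

Lemma chord_at_in f p : matching_on [set: 'I_n.*2] f -> chord_at f p \in chords_of f.
Proof.
case/matching_onP => fK fx; have : f p != p by rewrite fx inE.
rewrite neq_ltn_ord inE /chord_at => /orP[lt_fp|lt_pf]; last by rewrite lt_pf /= lt_pf eqxx.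
have -> : (p < f p) = false by rewrite ltnNge ltnW.
by rewrite /= lt_fp fK eqxx.
Qed.

Lemma chord_at1 f c : c \in chords_of f -> chord_at f c.1 = c.
Proof.
by rewrite inE /chord_at => /andP[lt_c /eqP ->]; rewrite lt_c -surjective_pairing.
Qed.

Lemma chord_at_partner f p : matching_on [set: 'I_n.*2] f -> chord_at f (f p) = chord_at f p.
Proof.
case/matching_onP => fK fx; have : f p != p by rewrite fx inE.
by rewrite /chord_at fK -val_eqE /=; case: ltngtP.
Qed.

(** Once the cases of a common chord are set aside, the four ends are distinct, and interleaving of
    ordered chords agrees with separation of ends. *)
Lemma crossing_chord_at f p q : matching_on [set: 'I_n.*2] f ->
  crossing (chord_at f p) (chord_at f q) = crosses f p q.
Proof.
move=> Hf; have /matching_onP[fK fx] := Hf.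
have self : crossing (chord_at f p) (chord_at f p) = false.
  by rewrite /crossing; move: (chord_at f p) => c; lia.
case: (eqVneq q p) => [->|qp].
  by rewrite self /crosses /between; lia.
case: (eqVneq q (f p)) => [->|qfp].
  by rewrite chord_at_partner // crosses_partner // self /crosses /between; lia.
have : f p != p by rewrite fx inE.
have : f q != q by rewrite fx inE.
have : f q != p by rewrite -[p]fK (inj_eq (can_inj fK)).
have : f q != f p by rewrite (inj_eq (can_inj fK)).
move: qp qfp; rewrite -!val_eqE /crossing /crosses /between /chord_at.
by case: (ltnP p (f p)) => h1; case: (ltnP q (f q)) => h2 /=;
  move: h1 h2; move: (nat_of_ord p) (nat_of_ord (f p)) (nat_of_ord q) (nat_of_ord (f q)) => a b c d; lia.
Qed.

Lemma connect_invariant (T : finType) (e : rel T) (P : pred T) x y :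
  (forall x y, e x y -> P x -> P y) -> connect e x y -> P x -> P y.
Proof.
move=> step /connectP[s + ->]; elim: s x => //= z s IH x /andP[/step xz] /IH zs /xz.
exact: zs.
Qed.

Lemma connected_partner (D : diagram n) :
  connected_or_empty D = connected_on [set: 'I_n.*2] (partner (chords D)).
Proof.
have HD : perfect_matching (chords D) := valP D.
have Hf := matching_partner HD; have DE := chords_of_partner HD.
set f := partner _ in Hf DE *.
have inD p : chord_at f p \in chords D by rewrite -DE chord_at_in.
rewrite /connected_or_empty /connected; case: (posnP n) => [n0|n0] /=.
  apply/esym/connected_onP => A _ /set0Pn[[i Hi]]; exfalso.
  by move: Hi; rewrite n0.
apply/idP/connected_onP => [/forall_inP conD A _ /set0Pn[p pA] /crossing_closedP cA|conf].
  apply/setP => q; rewrite inE.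
  have at_A x : (chord_at f x).1 \in A -> x \in A.
    by rewrite /chord_at; case: ifP => //= _ /cA[]; have /matching_onP[->] := Hf.
  have A_at x : x \in A -> (chord_at f x).1 \in A.
    by rewrite /chord_at; case: ifP => //= _ /cA[].
  have := forall_inP (conD _ (inD p)) _ (inD q).
  (* Having its first end in the closed set [A] is a property of chords that every edge of the
     intersection graph preserves. *)
  move/(@connect_invariant _ _ (fun c => c.1 \in A)) => H.
  apply/at_A/H; last exact: A_at.
  move=> v w /and3P[vD wD].
  have := crossing_chord_at v.1 w.1 Hf; rewrite !chord_at1 ?DE // => -> cvw vA.
  by have [_] := cA _ vA; apply.
apply/forall_inP => v vD; apply/forall_inP => w wD.
(* The points of the chords reachable from [v] form a closed set, hence all points. *)
pose A := [set p | connect (intersection_graph D) v (chord_at f p)].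
have AE : A = setT.
  apply: conf => //.
    by apply/set0Pn; exists v.1; rewrite inE chord_at1 ?DE.
  apply/crossing_closedP => p; rewrite inE => vp; split; first by rewrite inE chord_at_partner.
  move=> y cpy; rewrite inE; apply: connect_trans vp (connect1 _).
  by rewrite /intersection_graph !inD crossing_chord_at.
by have : w.1 \in A by [rewrite AE]; rewrite inE chord_at1 ?DE.
Qed.

(** Both diagrams cover each point exactly once, so one inclusion is enough. *)
Lemma diagram_sub (D E : diagram n) : chords D \subset chords E -> D = E.
Proof.
move/subsetP => DE; apply: val_inj; apply/setP => c /=; apply/idP/idP => [/DE //|cE].
have /perfect_matchingP[_ /(_ c.1)[d [dD pd] _]] := valP D.
have /perfect_matchingP[_ /(_ c.1)[e _ He]] := valP E.
have pc : endpoint c.1 c by rewrite /endpoint eqxx.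
by rewrite (He c cE pc) -(He d (DE d dD) pd).
Qed.

End Partner.

Lemma num_connected_diagrams n :
  #|[set D : diagram n | connected_or_empty D]| = num_connected_matchings n.*2.
Proof. by apply: card_diagrams => D; apply: connected_partner. Qed.

(** * Concatenation and stable prefixes *)

Lemma point_cases m k (p : 'I_(m + k).*2) :
  (exists i, p = left_point k i) \/ (exists i, p = right_point m i).
Proof.
rewrite -[p](cast_ordK (doubleD m k)).
by case: (split_ordP (cast_ord (doubleD m k) p)) => i ->; [left | right]; exists i.
Qed.

Lemma left_point_inj m k : injective (@left_point m k).
Proof. by move=> i j /(congr1 val) /= e; apply: val_inj. Qed.

Lemma right_point_inj m k : injective (@right_point m k).
Proof. by move=> i j /(congr1 val) /= /addnI e; apply: val_inj. Qed.

Lemma concat_stable m k (D : diagram m) (E : diagram k) :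
  stable (below (m + k).*2 m.*2) (partner (chords (concat D E))).
Proof.
apply/stableP => x; rewrite !inE; case: (point_cases x) => -[i ->] /=; last first.
  by rewrite ltnNge leq_addr.
move=> _; have /perfect_matchingP[_ /(_ i)[c [cD ic] _]] := valP D.
have cC : left_chord k c \in chords (concat D E) by rewrite inE imset_f.
have [e1 e2] := partner_chord (valP (concat D E)) cC.
by case/orP: ic => /eqP ->; [rewrite [partner _ _]e1 | rewrite [partner _ _]e2] => /=.
Qed.

(** Stability means that no chord straddles the cut after [m.*2] points, so the chords on either
    side form a diagram of their own. *)
Lemma stable_concat m k (D : diagram (m + k)) :
  stable (below (m + k).*2 m.*2) (partner (chords D)) ->
  exists E F, concat E F = D.
Proof.
move=> sD; have HD : perfect_matching (chords D) := valP D.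
have /perfect_matchingP[lt_D unique_D] := HD.
have /matching_onP[fK _] := matching_partner HD.
have same c : c \in chords D -> (c.1 < m.*2) = (c.2 < m.*2).
  move=> cD; have [<- _] := partner_chord HD cD.
  by have := stable_involutive c.1 fK sD; rewrite !inE.
have HE : perfect_matching [set c : chord m | left_chord k c \in chords D].
  apply/perfect_matchingP; split=> [c|p]; first by rewrite inE => /lt_D.
  have [c [cD pc] Hc] := unique_D (left_point k p).
  have := same c cD; case: (point_cases c.1) => -[i e1]; case: (point_cases c.2) => -[j e2].
  - move=> _; exists (i, j).
      rewrite inE /left_chord /= -e1 -e2 -surjective_pairing; split=> //.
      by move: pc; rewrite /endpoint e1 e2 !(inj_eq (@left_point_inj m k)).
    move=> d; rewrite inE => dD pd; have := Hc _ dD.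
    rewrite /endpoint /= !(inj_eq (@left_point_inj m k)) => /(_ pd) dc.
    move: e1 e2; rewrite -dc /= => /left_point_inj <- /left_point_inj <-.
    by rewrite -surjective_pairing.
  - by rewrite e1 e2 /= ltn_ord ltnNge leq_addr.
  - by rewrite e1 e2 /= ltn_ord ltnNge leq_addr.
  - move=> _; move: pc; rewrite /endpoint e1 e2 -!val_eqE /=.
    by case/orP => /eqP e; have := ltn_ord p; rewrite e ltnNge leq_addr.
have HF : perfect_matching [set c : chord k | right_chord m c \in chords D].
  apply/perfect_matchingP; split=> [c|p].
    by rewrite inE => /lt_D /=; rewrite ltn_add2l.
  have [c [cD pc] Hc] := unique_D (right_point m p).
  have := same c cD; case: (point_cases c.1) => -[i e1]; case: (point_cases c.2) => -[j e2].
  - move=> _; move: pc; rewrite /endpoint e1 e2 -!val_eqE /=.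
    by case/orP => /eqP e; [have := ltn_ord i | have := ltn_ord j]; rewrite -e ltnNge leq_addr.
  - by rewrite e1 e2 /= ltn_ord ltnNge leq_addr.
  - by rewrite e1 e2 /= ltn_ord ltnNge leq_addr.
  - move=> _; exists (i, j).
      rewrite inE /right_chord /= -e1 -e2 -surjective_pairing; split=> //.
      by move: pc; rewrite /endpoint e1 e2 !(inj_eq (@right_point_inj m k)).
    move=> d; rewrite inE => dD pd; have := Hc _ dD.
    rewrite /endpoint /= !(inj_eq (@right_point_inj m k)) => /(_ pd) dc.
    move: e1 e2; rewrite -dc /= => /right_point_inj <- /right_point_inj <-.
    by rewrite -surjective_pairing.
exists (Diagram HE), (Diagram HF); apply: diagram_sub; apply/subsetP => c.
by rewrite inE => /orP[] /imsetP[d + ->]; rewrite inE.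
Qed.

(** The sizes [k + 0] and [k] are not convertible, so the equality is between tagged diagrams and is
    checked on the numerical values of the ends. *)
Lemma concat_empty k (D : diagram k) :
  Tagged diagram (concat D empty_diagram) = Tagged diagram D.
Proof.
have sized_eq (j : nat) (E : diagram j) (F : diagram k) : j = k ->
    (forall c, c \in chords E -> exists2 d, d \in chords F & (c.1 = d.1 :> nat) /\ (c.2 = d.2 :> nat)) ->
    Tagged diagram E = Tagged diagram F.
  move=> ejk; case: _ / ejk in F * => EF; congr Tagged.
  apply: diagram_sub; apply/subsetP => c /EF[d dF [e1 e2]].
  by rewrite [c]surjective_pairing (val_inj e1) (val_inj e2) -surjective_pairing.
apply: sized_eq; first by rewrite addn0.
move=> c; rewrite inE => /orP[] /imsetP[d dD ->]; first by exists d.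
by rewrite inE in dD.
Qed.

Lemma indecomposable_partner n (D : diagram n) :
  `[< indecomposable D >] = no_stable_prefix n.*2 (partner (chords D)).
Proof.
apply/asboolP/forallP => [indec q|no_prefix [s [size_s pos_s eD]]].
  apply/implyP => q0; apply/negP => st; apply: indec.
  have HD : perfect_matching (chords D) := valP D.
  have Hf := matching_partner HD.
  (* A stable prefix carries a perfect matching of its own, so its length is even and the cut falls
     between whole diagrams. *)
  have even_q : ~~ odd q.
    apply/negP => /num_matchings_odd; rewrite -[q in num_matchings q](@card_below n.*2) 1?ltnW //.
    rewrite -card_matchings => /eqP; rewrite cards_eq0 => /eqP/setP.
    move/(_ (restrict (below n.*2 q) (partner (chords D)))).
    by rewrite !inE andbT (matching_restrict Hf).
  have qE : q = q./2.*2 :> nat by rewrite -[LHS]odd_double_half (negbTE even_q).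
  move: q0 st; rewrite {}qE => q0 st.
  have mn : (q./2 < n) by have := ltn_ord q; lia.
  move: (q./2) mn q0 st => m mn m0.
  have nE : n = m + (n - m) by lia.
  have km : 0 < n - m by lia.
  move: (n - m) nE km => k nE k0; subst n => st.
  have [E [F DE]] := stable_concat st.
  exists [:: Tagged diagram E; Tagged diagram F]; split=> //=; first by rewrite k0 andbT; lia.
  rewrite -DE.
  exact: (congr1 (fun u : sized_diagram => Tagged diagram (concat E (tagged u))) (concat_empty F)).
(* The property is stated on sized diagrams so that [eD], an equality of dependent pairs, can be
   rewritten without casts. *)
pose bad (u : sized_diagram) :=
  [exists q : 'I_(tag u).*2, (0 < q) && stable (below (tag u).*2 q) (partner (chords (tagged u)))].
have : bad (Tagged diagram D).
  rewrite -eD; case: s size_s pos_s {eD} => [|E [|F s]] //= _ /and3P[E0 F0 _].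
  set G := concat_seq (F :: s) .
  have G0 : 0 < tag G by rewrite /G size_concat_seq /= addn_gt0 F0.
  have lt : (tag E).*2 < (tag E + tag G).*2 by lia.
  apply/existsP; exists (Ordinal lt); rewrite /= double_gt0 E0.
  exact: concat_stable.
by case/existsP => q /andP[q0 st]; have := no_prefix q; rewrite q0 st.
Qed.

Lemma num_indecomposable_prefix_free n : num_indecomposable n = num_prefix_free n.*2.
Proof. by apply: card_diagrams => D; apply: indecomposable_partner. Qed.

(** * Generating series *)

Local Open Scope ring_scope.

(** Congruence modulo [X^(n+1)]: power series are handled as truncated polynomials. *)
Definition eq_upto n (p q : {poly rat}) := forall i, (i <= n)%N -> p`_i = q`_i.

Lemma eq_upto_mul n p p' q q' :
  eq_upto n p p' -> eq_upto n q q' -> eq_upto n (p * q) (p' * q').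
Proof.
move=> pp qq i le_in; rewrite !coefM; apply: eq_bigr => j _.
by rewrite pp ?qq // (leq_trans _ le_in) ?leq_subr // -ltnS.
Qed.

Lemma eq_upto_exp n p q k : eq_upto n p q -> eq_upto n (p ^+ k) (q ^+ k).
Proof.
by move=> pq; elim: k => [|k IH]; [move=> i _ | rewrite !exprS; apply: eq_upto_mul].
Qed.

(* Expanding [m^n = k(x m)^n] as [\sum_j f_j (x m)^j] and multiplying by
   [e^n (1 + x m' e)], the term [j] contributes [f_j [x^s] e^s (1 + x m' e)] with
   [s = n - j], and for [s > 0] this vanishes because
   [x m' e e^s = - x e' e^(s-1) = - x (e^s)' / s]. *)
Lemma lagrange_diagonal n (m k e : {poly rat}) : m`_0 = 1 ->
  eq_upto n (m * e) 1 -> eq_upto n (k \Po ('X * m)) m ->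
  (k ^+ n)`_n = (1 + 'X * (m^`() * e))`_n.
Proof.
move=> m0 me km; set W := 1 + 'X * (m^`() * e); set f := k ^+ n.
have e0 : e`_0 = 1.
  by have := me 0%N isT; rewrite coefM big_ord1 m0 mul1r subnn coef1.
(* This is the derivative of [m e = 1]. Differentiating loses one order of precision, which the
   factor ['X] restores. *)
have me' : eq_upto n ('X * (m^`() * e)) (- ('X * (m * e^`()))).
  move=> [|i] le_in; rewrite coefN !coefXM ?oppr0 //=.
  apply/eqP; rewrite -addr_eq0 -coefD; apply/eqP.
  have -> : m^`() * e + m * e^`() = (m * e)^`() by rewrite derivM.
  by rewrite coef_deriv me // coef1 mul0rn.
have vanish s : (0 < s <= n)%N -> (e ^+ s * W)`_s = 0.
  case: s => // s le_sn.
  have eWE : eq_upto n (e ^+ s.+1 * W) (e ^+ s.+1 - 'X * (e^`() * e ^+ s)).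
    move=> i le_in; rewrite /W mulrDr mulr1 !coefD coefN; congr (_ + _).
    rewrite (eq_upto_mul (p' := e ^+ s.+1) _ me') // mulrN coefN; congr (- _).
    have -> : e ^+ s.+1 * ('X * (m * e^`())) = (m * e) * ('X * (e^`() * e ^+ s)).
      rewrite exprS; ring.
    by rewrite (eq_upto_mul (q' := 'X * (e^`() * e ^+ s)) me) // mul1r.
  rewrite eWE // coefB coefXM /=.
  (* Coefficient [s] of this derivative is computed in two ways; cancelling [s.+1] shows that the
     two terms of the difference agree. *)
  have dE : (e ^+ s.+1)^`() = (e^`() * e ^+ s) *+ s.+1 by rewrite deriv_exp.
  have := coef_deriv (e ^+ s.+1) s; rewrite dE coefMn => /eqP.
  by rewrite -subr_eq0 -mulrnBl mulrn_eq0 /= subr_eq0 => /eqP ->; rewrite subrr.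
have mE : eq_upto n (f \Po ('X * m)) (m ^+ n).
  by rewrite /f rmorphXn /=; apply: eq_upto_exp.
have meX j : eq_upto n ((m * e) ^+ j) 1 by rewrite -(expr1n _ j); apply: eq_upto_exp.
transitivity ((f \Po ('X * m)) * (e ^+ n * W))`_n; last first.
  rewrite (eq_upto_mul (q' := e ^+ n * W) mE) // mulrA -exprMn.
  by rewrite (eq_upto_mul (q' := W) (meX n)) // mul1r.
rewrite comp_polyE mulr_suml coef_sum.
have termE (j : nat) : (f`_j *: ('X * m) ^+ j * (e ^+ n * W))`_n = if j == n then f`_n else 0.
  rewrite -scalerAl coefZ exprMn -mulrA coefXnM.
  case: ltngtP => [lt_nj|lt_jn|->]; first by rewrite mulr0.
    have -> : m ^+ j * (e ^+ n * W) = (m * e) ^+ j * (e ^+ (n - j) * W).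
      by rewrite exprMn -mulrA [e ^+ j * _]mulrA -exprD subnKC // ltnW.
    rewrite (eq_upto_mul (q' := e ^+ (n - j) * W) (meX j)) ?leq_subr // mul1r.
    by rewrite vanish ?mulr0 // subn_gt0 lt_jn leq_subr.
  rewrite subnn mulrA -exprMn (eq_upto_mul (q' := W) (meX j)) // mul1r.
  by rewrite /W coefD coef1 coefXM /= addr0 mulr1.
under eq_bigr => j _ do rewrite termE.
rewrite -big_mkcond /=; case: (ltnP n (size f)) => [lt_n|le_n].
  by rewrite (big_pred1 (Ordinal lt_n)) // => j; rewrite -val_eqE.
rewrite nth_default // big_pred0 // => j; apply/negbTE.
by rewrite neq_ltn (leq_trans (ltn_ord j) le_n).
Qed.

Lemma series_exp_poly a N k n : (n <= N)%N ->
  series_exp a k n = ((\poly_(i < N.+1) a i) ^+ k)`_n.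
Proof.
elim: k n => [|k IH] n le_nN; first by rewrite expr0 coef1.
rewrite exprS coefM /=; apply: eq_bigr => i _.
by rewrite coef_poly (leq_trans (ltn_ord i)) // IH // (leq_trans (leq_subr _ _)).
Qed.

(** * The functional equations and the diagonal coefficients *)

Definition matching_poly N : {poly rat} := \poly_(i < N.+1) (num_matchings i)%:R.

Definition connected_poly N : {poly rat} := \poly_(i < N.+1) (num_connected_matchings i)%:R.

(** This truncates the series [E]. The constant term is set apart because the empty matching is
    itself prefix-free and would otherwise contribute [-1]. *)
Definition prefix_free_poly N : {poly rat} :=
  \poly_(i < N.+1) (if i is 0%N then 1 else - (num_prefix_free i)%:R).

Lemma matching_prefix_free N : eq_upto N (matching_poly N * prefix_free_poly N) 1.
Proof.
move=> [|i] le_iN; rewrite mulrC coefM coef1.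
  by rewrite big_ord1 !coef_poly /= mul1r num_matchings0.
rewrite big_ord_recl /= subn0 !coef_poly /= mul1r ltnS le_iN num_matchings_prefix // natr_sum.
rewrite -big_split big1 // => j _ /=.
rewrite /bump leq0n add1n !coef_poly !ltnS (leq_trans _ le_iN) ?ltn_ord //.
by rewrite (leq_trans (leq_subr _ _) le_iN) natrM; ring.
Qed.

(** Each of the [k] points contributes a factor ['X], and the gap after it a factor
    [matching_poly N]. *)
Lemma num_gapped_coef N n k p : (p <= n <= N)%N ->
  (num_gapped n k p)%:R = (('X * matching_poly N) ^+ k)`_p.
Proof.
case/andP=> pn nN; elim: k p pn => [|k IH] p pn.
  by rewrite num_gapped0 // expr0 coef1.
rewrite num_gappedS // exprSr mulrCA coefXM; case: p pn => [|p] pn; first by rewrite big_ord0.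
rewrite coefM natr_sum; apply: eq_bigr => j _; rewrite natrM.
rewrite IH ?(leq_trans _ pn) 1?ltnW // subSS coef_poly ltnS.
by rewrite (leq_trans (leq_subr _ _)) // (leq_trans _ nN) // ltnW.
Qed.

Lemma connected_matching N :
  eq_upto N (connected_poly N \Po ('X * matching_poly N)) (matching_poly N).
Proof.
move=> p pN; rewrite {1}/connected_poly poly_def raddf_sum coef_sum.
rewrite [RHS]coef_poly ltnS pN num_matchings_gapped natr_sum.
(* The sum over [k <= p] is padded to [k <= N]: [X^k] divides the [k]-th power, so terms with
   [p < k] vanish. *)
rewrite (big_ord_widen N.+1
  (fun k => (num_connected_matchings k * num_gapped p k p)%:R)) ?ltnS // [RHS]big_mkcond /=.
apply: eq_bigr => k _; rewrite comp_polyZ comp_Xn_poly coefZ.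
case: ltnP => [_|lt_pk]; first by rewrite natrM (@num_gapped_coef N) ?leqnn ?pN.
by rewrite exprMn coefXnM lt_pk mulr0.
Qed.

(** The factor [n.+1] in the recurrence for [num_matchings n.+2] is the action of the operator
    [1 + z d/dz]. *)
Lemma matching_deriv N :
  eq_upto N.+2 (matching_poly N.+2 - 1)
    ('X * ('X * (matching_poly N.+2 + 'X * (matching_poly N.+2)^`()))).
Proof.
move=> [|[|i]] le_iN; rewrite coefB coef1 coef_poly ?coefXM /=.
- by rewrite num_matchings0 subrr.
- by rewrite num_matchings1 subr0.
rewrite ltnS le_iN subr0 coefD coefXM num_matchingsSS natrM.
have iN : (i < N.+3)%N by rewrite ltnW // ltnW.
case: i le_iN iN => [|i] le_iN iN /=; rewrite ?coef_deriv !coef_poly iN.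
  by rewrite mul1r addr0.
by rewrite -mulr_natl -[i.+2%:R]natr1; ring.
Qed.

Lemma connected_diagonal N : (connected_poly N.+2 ^+ N)`_N = (num_prefix_free N.+2)%:R.
Proof.
set m := matching_poly N.+2; set e := prefix_free_poly N.+2.
have up p q : eq_upto N.+2 p q -> eq_upto N p q.
  by move=> pq i iN; rewrite pq // (leq_trans iN) // leqW.
have me : eq_upto N.+2 (m * e) 1 := @matching_prefix_free N.+2.
rewrite (@lagrange_diagonal N m _ e) ?coef_poly /= ?num_matchings0 //; last 2 first.
- exact: up.
- exact/up/connected_matching.
(* The equation for [m - 1] is multiplied by [e]. Coefficient [N.+2] of [m e - e] is the prefix-free
   count, and the other side is [z^2 (1 + z m' e)] up to that order; this is why the truncation goes
   to [N.+2]. *)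
have := eq_upto_mul (@matching_deriv N) (fun i _ => erefl e`_i) (leqnn N.+2).
rewrite -/m mulrBl mul1r coefB me // coef1 sub0r.
rewrite [e`_ _]coef_poly ltnSn opprK => ->.
have -> : 'X * ('X * (m + 'X * m^`())) * e = 'X * ('X * (m * e + 'X * (m^`() * e))) by ring.
by rewrite !coefXM /= !coefD (up _ _ me).
Qed.

Lemma num_connected_pairsE n :
  num_connected_pairs n =
  (\sum_(i < n.+1) num_connected_matchings i.*2 * num_connected_matchings (n - i).*2)%N.
Proof.
rewrite /num_connected_pairs -sum1_card.
under eq_bigl => u do rewrite inE.
rewrite -(@sig_big_dep _ _ _ _ _ xpredT
  (fun (i : 'I_n.+1) (u : diagram i * diagram (n - i)) =>
     connected_or_empty u.1 && connected_or_empty u.2) (fun _ _ => 1%N)).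
apply: eq_bigr => i _; rewrite -!num_connected_diagrams -cardsX sum1_card.
by apply: eq_card => u; rewrite !inE.
Qed.

Lemma num_connected_matchings_odd n : odd n -> num_connected_matchings n = 0%N.
Proof.
move=> /num_matchings_odd m0; apply/eqP; rewrite -leqn0 -m0.
by apply/subset_leq_card/subsetP => f; rewrite !inE andbT => /andP[].
Qed.

Lemma connected_pairs_diagonal n :
  series_exp (fun i => (num_connected_pairs i)%:R) n n = (num_indecomposable n.+1)%:R.
Proof.
rewrite num_indecomposable_prefix_free doubleS -connected_diagonal.
rewrite (@series_exp_poly _ n) //.
pose c : {poly rat} := \poly_(i < n.+1) (num_connected_matchings i.*2)%:R.
have cc : eq_upto n (\poly_(i < n.+1) (num_connected_pairs i)%:R) (c ^+ 2).
  move=> i le_in; rewrite coef_poly ltnS le_in num_connected_pairsE natr_sum expr2 coefM.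
  apply: eq_bigr => j _; rewrite natrM !coef_poly !ltnS.
  have le_ji : (j <= i)%N by rewrite -ltnS.
  by rewrite (leq_trans le_ji le_in) (leq_trans (leq_subr j i) le_in).
rewrite (eq_upto_exp n cc) // -exprM mul2n.
(* Connected matchings have an even number of points, so [K(z) = c(z^2)]. Hence coefficient [2n] of
   [K^(2n)] is coefficient [n] of [(c^2)^n], where [c^2] counts the pairs. *)
have kc : eq_upto n.*2 (connected_poly n.*2.+2) (c \Po 'X^2).
  move=> i le_in; rewrite coef_comp_poly_Xn // coef_poly ltnS (leq_trans le_in) 1?leqW //.
  rewrite dvdn2; case: (boolP (odd i)) => /= [/num_connected_matchings_odd -> //|even_i].
  rewrite coef_poly; have -> : (i %/ 2 < n.+1)%N by lia.
  by have -> : ((i %/ 2).*2 = i)%N by lia.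
rewrite (eq_upto_exp n.*2 kc) // -rmorphXn /= coef_comp_poly_Xn //.
by rewrite dvdn2 odd_double /= divn2 doubleK.
Qed.

Theorem proposition4p6 (a : nat -> rat) (ha : is_A088221 a) (n : nat) :
  a n = (num_connected_pairs n)%:R.
Proof.
suff pairs_A088221 : is_A088221 (fun i => (num_connected_pairs i)%:R).
  exact: (A088221_unique ha pairs_A088221).
split; last exact: connected_pairs_diagonal.
by rewrite num_connected_pairsE big_ord1 num_connected_matchings0.
Qed.
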